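(* Let $\mathcal{C}=\{X_1,\dots,X_k\}$ be a collection of itemsets over items $A=\{a_1,\dots,a_N\}$, let $D$ be a dataset, and let $p^*_{\mathcal{C}}$ be the maximum entropy distribution on $\mathcal{T}=\{0,1\}^N$ subject to $p(X_i=1)=\mathrm{fr}(X_i\mid D)$ for $i=1,\dots,k$. Let $r(A=t\mid f_1,\dots,f_k)$ be an alternative statistical model, i.e. for each vector of frequencies $(f_1,\dots,f_k)$ a distribution on $\mathcal{T}$, and for a dataset $D'$ write $r(D'\mid f_1,\dots,f_k)=\prod_{t\in D'}r(A=t\mid f_1,\dots,f_k)$ and $r(D')=r(D'\mid \mathrm{fr}(X_1\mid D'),\dots,\mathrm{fr}(X_k\mid D'))$. Assume that for any two datasets $D_1,D_2$ with $\mathrm{fr}(X\mid D_1)=\mathrm{fr}(X\mid D_2)=:f_X$ for all $X\in\mathcal{C}$ it holds that $$\frac{1}{|D_1|}\log r(D_1\mid f_{X_1},\dots,f_{X_k})=\frac{1}{|D_2|}\log r(D_2\mid f_{X_1},\dots,f_{X_k}).$$ Then $p^*_{\mathcal{C}}(D)\ge r(D)$ for any dataset $D$.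
   Context: Transactions are $t\in\mathcal{T}=\{0,1\}^N$; an itemset $X\subseteq A$ is supported by $t$ iff $t_i=1$ for all $a_i\in X$. A dataset is a finite nonempty multiset of transactions, and $\mathrm{fr}(X\mid D)$ is the fraction of transactions of $D$ (with multiplicity) supporting $X$. For a distribution $p$ on $\mathcal{T}$, $p(X=1)$ is the probability that a random transaction supports $X$, and $p(D)=\prod_{t\in D}p(A=t)$. The maximum entropy distribution is the unique distribution maximizing $H(p)=-\sum_t p(A=t)\log p(A=t)$ among those satisfying the stated constraints; logarithms are base 2. *)

(* Defs.v *)
From mathcomp Require Import all_boot all_order all_algebra finmap multiset.
From mathcomp Require Import all_classical all_reals all_analysis.

Set Implicit Arguments.
Unset Strict Implicit.
Unset Printing Implicit Defensive.

Import Order.TTheory GRing.Theory Num.Theory.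
Local Open Scope ring_scope.

(* The N items are identified with their indices in 'I_N. *)
Notation transaction N := {ffun 'I_N -> bool}.
Notation itemset N := {set 'I_N}.

(* Non-emptiness is not part of the type: it is [D != mset0] wherever a dataset
   is quantified over. *)
Notation dataset N := {mset transaction N}%mset.

Definition supports N (X : itemset N) (t : transaction N) : bool :=
  [forall i in X, t i].

Section Frequencies.
Variable R : realType.

Definition fr N (X : itemset N) (D : dataset N) : R :=
  (count (supports X) D)%:R / (size D)%:R.

Definition frequencies N k (C : 'I_k -> itemset N) (D : dataset N) :
  {ffun 'I_k -> R} := [ffun i => fr (C i) D].

End Frequencies.

Section Distributions.
Variables (R : realType) (N : nat).
Implicit Types (p q : transaction N -> R).

Definition is_distribution p : Prop :=
  (forall t, 0 <= p t) /\ \sum_t p t = 1.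

(* p(X = 1) *)
Definition support_prob p (X : itemset N) : R := \sum_(t | supports X t) p t.

(* p(D); D coerces to the sequence of its elements, with repetitions. *)
Definition likelihood p (D : dataset N) : R := \prod_(t <- D) p t.

(* Extended-real valued, so that log2 0 = -oo (whereas [ln 0 = 0]). *)
Definition log2 (x : R) : \bar R := (lne x%:E * ((ln 2)^-1)%:E)%E.

(* The convention 0 log 0 = 0 is [0 * -oo = 0] in \bar R. *)
Definition entropy p : \bar R := (- \sum_t (p t)%:E * log2 (p t))%E.

Definition satisfies k (C : 'I_k -> itemset N) (f : {ffun 'I_k -> R}) p : Prop :=
  is_distribution p /\ forall i, support_prob p (C i) = f i.

Definition is_maxent k (C : 'I_k -> itemset N) (f : {ffun 'I_k -> R}) p : Prop :=
  satisfies C f p /\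
  forall q, satisfies C f q -> (entropy q <= entropy p)%E.

(* The values of r on vectors that cannot be frequencies are irrelevant. *)
Definition is_model k (r : {ffun 'I_k -> R} -> transaction N -> R) : Prop :=
  forall f : {ffun 'I_k -> R}, (forall i, 0 <= f i <= 1) -> is_distribution (r f).

End Distributions.

(* Main.v *)
Require Import Defs.
From mathcomp Require Import all_boot all_order all_algebra finmap multiset.
From mathcomp Require Import all_classical all_reals all_analysis.
From mathcomp Require Import ring lra.
Import Order.TTheory GRing.Theory Num.Theory.
Import numFieldNormedType.Exports.
Local Open Scope ring_scope.

(* Write h for \sum_t pstar t * ln (pstar t).
   Mixing pstar with the empirical distribution q of D keeps the constraints, so
   m_e = (1 - e) pstar + e q has entropy at most that of pstar; with Gibbs'
   inequality this gives \sum_t q t * ln (m_e t) >= h for 0 < e < 1, and e -> 0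
   yields p(D) >= exp(|D| h), even where pstar vanishes.
   If s = r(. | f) has s(D) > 0, then \sum_t q' t * ln (s t) takes the same value
   on every empirical distribution q' satisfying the constraints. The constraints
   are rational, so pstar, which may be irrational, is a limit of such q' with the
   same support; hence the value is also \sum_t pstar t * ln (s t) <= h, i.e.
   s(D) <= exp(|D| h). *)

(** * Rational and integer approximation of real solutions of rational linear systems *)

(** Kernels commute with field extension, so [x] is a real combination of the rational rows of
    [kermx A]; rounding its coefficients to rationals stays in the kernel. *)
Lemma rational_kernel_approx {R : realType} {I J : finType}
    {M : I -> J -> rat} {x : J -> R} {eps : R} :
    0 < eps -> (forall i, \sum_j ratr (M i j) * x j = 0) ->
  exists z : J -> rat, (forall i, \sum_j M i j * z j = 0) /\
    forall j, `|x j - ratr (z j)| < eps.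
Proof.
move=> eps_gt0 Mx.
pose A : 'M[rat]_(#|J|, #|I|) := \matrix_(j, i) M (enum_val i) (enum_val j).
pose X : 'rV[R]_#|J| := \row_j x (enum_val j).
have: (X <= map_mx (ratr : rat -> R) (kermx A))%MS.
  rewrite map_kermx; apply/sub_kermxP/rowP => i.
  rewrite !mxE -[RHS](Mx (enum_val i)) (reindex (@enum_val _ J)) /=.
    by apply: eq_bigr => j _; rewrite !mxE mulrC.
  by apply: onW_bij; exact: enum_val_bij.
case/submxP => Y defX.
pose K := kermx A.
pose B : R := 1 + \sum_i \sum_j `|ratr (K i j)|.
have sumK_ge0 : 0 <= \sum_i \sum_j `|ratr (K i j) : R|.
  by do 2![apply: sumr_ge0 => ? _].
have B_gt0 : 0 < B by rewrite /B; lra.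
pose del := eps / B.
have del_gt0 : 0 < del by rewrite divr_gt0.
have approxY i : exists q : rat, `|Y 0 i - ratr q| < del.
  have /rat_in_itvoo[q] : Y 0 i - del < Y 0 i + del by lra.
  by rewrite in_itv /= => /andP[? ?]; exists q; rewrite ltr_norml; lra.
have [q qY] := choice approxY.
pose Z : 'rV[rat]_#|J| := (\row_i q i) *m K.
exists (fun j => Z 0 (enum_rank j)); split => [i|j].
  have /rowP/(_ (enum_rank i)) : Z *m A = 0.
    by apply/sub_kermxP; exact: submxMl.
  rewrite mxE [RHS]mxE => ZA; rewrite -[RHS]ZA [RHS](reindex (@enum_rank J)) /=; last first.
    by apply: onW_bij; exact: enum_rank_bij.
  by apply: eq_bigr => j _; rewrite [A _ _]mxE !enum_rankK mulrC.
have -> : x j = X 0 (enum_rank j) by rewrite mxE enum_rankK.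
rewrite defX mxE [Z _ _]mxE rmorph_sum -sumrB.
apply: (@le_lt_trans _ _ (\sum_i del * `|ratr (K i (enum_rank j))|)).
  apply: (le_trans (ler_norm_sum _ _ _)); apply: ler_sum => i _.
  by rewrite [map_mx _ _ _ _]mxE [(\row_i q i) _ _]mxE rmorphM -mulrBl normrM ler_wpM2r // ltW.
rewrite -mulr_sumr /del -mulrA gtr_pMr // mulrC ltr_pdivrMr // mul1r.
apply: (@le_lt_trans _ _ (\sum_i \sum_j `|ratr (K i j)|)); last first.
  by rewrite /B; lra.
apply: ler_sum => i _; rewrite [leRHS](bigD1 (enum_rank j)) //= lerDl.
exact: sumr_ge0.
Qed.

Lemma common_denominator {T : finType} {z : T -> rat} :
    (forall t, 0 <= z t) ->
  exists (d : nat) (n : T -> nat), (0 < d)%N /\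
    forall t, (n t)%:R = d%:R * z t.
Proof.
move=> z_ge0; exists (\prod_t `|denq (z t)|)%N.
exists (fun t => `|numq (z t)| * \prod_(u | u != t) `|denq (z u)|)%N; split.
  by apply: prodn_gt0 => t; rewrite absz_gt0 denq_neq0.
move=> t; rewrite [in RHS](bigD1 t) //= !natrM mulrAC; congr (_ * _).
rewrite !pmulrn !abszE normr_denq ger0_norm ?numq_ge0 //.
by rewrite mulrC -numqE.
Qed.

Lemma nat_kernel_approx {R : realType} {I T : finType} {M : I -> T -> rat}
    {x : T -> R} {eps : R} :
    0 < eps -> (forall t, 0 <= x t) ->
    (forall i, \sum_t ratr (M i t) * x t = 0) ->
  exists (d : nat) (n : T -> nat), [/\ (0 < d)%N,
    forall i, \sum_t M i t * (n t)%:R = 0,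
    forall t, (0 < n t)%N = (0 < x t) &
    forall t, `|x t - (n t)%:R / d%:R| < eps].
Proof.
move=> eps_gt0 x_ge0 Mx.
(* The extra equations force the rational solution to vanish where [x] does. *)
pose M' (i : I + T) (t : T) : rat :=
  match i with inl i => M i t | inr u => ((t == u) && (x u == 0))%:R end.
(* An error below the least positive value of [x] cannot destroy positivity. *)
pose e := \big[Num.min/eps]_(t | 0 < x t) x t.
have e_gt0 : 0 < e by apply/lt_bigmin.
have M'x i : \sum_t ratr (M' i t) * x t = 0.
  case: i => [i|u] //=; apply: big1 => t _.
  case: eqP => [->|] /=; last by rewrite rmorph0 mul0r.
  by case: eqP => [->|]; rewrite ?mulr0 ?rmorph0 ?mul0r.
have [z [M'z zx]] := rational_kernel_approx e_gt0 M'x.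
have z0 t : x t = 0 -> z t = 0.
  move=> xt0; rewrite -[RHS](M'z (inr t)) /= (bigD1 t) //= eqxx xt0 eqxx mul1r.
  by rewrite big1 ?addr0 // => u /negPf ->; rewrite mul0r.
have z_gt0 t : 0 < x t -> 0 < z t.
  move=> xt_gt0; rewrite -(ltr0q R).
  have : e <= x t by exact: bigmin_le_cond.
  by move: (zx t); rewrite ltr_norml; lra.
have z_ge0 t : 0 <= z t.
  have := x_ge0 t; rewrite le_eqVlt => /predU1P[/esym/z0 ->//|/z_gt0].
  exact: ltW.
have [d [n [d_gt0 nE]]] := common_denominator z_ge0.
exists d, n; split => // [i|t|t].
- under eq_bigr do rewrite nE mulrCA.
  by rewrite -mulr_sumr (M'z (inl i)) mulr0.
- rewrite -(ltr0n rat) nE pmulr_rgt0 ?ltr0n //.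
  have := x_ge0 t; rewrite le_eqVlt => /predU1P[/esym xt0|xt_gt0].
    by rewrite z0 // xt0 !ltxx.
  by rewrite z_gt0.
- have -> : (n t)%:R / d%:R = ratr (z t) :> R.
    apply: (mulIf (_ : d%:R != 0 :> R)); first by rewrite pnatr_eq0 -lt0n.
    rewrite divfK ?pnatr_eq0 -?lt0n // -(ratr_nat R (n t)) nE rmorphM.
    by rewrite /= ratr_nat mulrC.
  by apply: (lt_le_trans (zx t)); exact: bigmin_le_id.
Qed.

(** A linear form is continuous, and it vanishes at the points [n / d], which come arbitrarily close
    to [x] and have its support. *)
Lemma linear_form_vanish {R : realType} {I T : finType} {M : I -> T -> rat}
    {x l : T -> R} :
    (forall t, 0 <= x t) -> (forall i, \sum_t ratr (M i t) * x t = 0) ->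
    (forall n : T -> nat, (forall i, \sum_t M i t * (n t)%:R = 0) ->
       (forall t, (0 < n t)%N = (0 < x t)) -> \sum_t (n t)%:R * l t = 0) ->
  \sum_t x t * l t = 0.
Proof.
move=> x_ge0 Mx l0.
pose B : R := 1 + \sum_t `|l t|.
have suml_ge0 : 0 <= \sum_t `|l t| by apply: sumr_ge0.
have B_gt0 : 0 < B by rewrite /B; lra.
apply/normr0_eq0/eqP; rewrite eq_le normr_ge0 andbT.
apply/ler_addgt0Pl => e e_gt0; rewrite addr0.
have del_gt0 : 0 < e / B by rewrite divr_gt0.
have [d [n [d_gt0 Mn nx xn]]] := nat_kernel_approx del_gt0 x_ge0 Mx.
have -> : \sum_t x t * l t = \sum_t (x t - (n t)%:R / d%:R) * l t.
  under [RHS]eq_bigr do rewrite mulrBl mulrAC.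
  by rewrite sumrB -[X in _ = _ - X]mulr_suml l0 // mul0r subr0.
apply: (@le_trans _ _ (\sum_t e / B * `|l t|)).
  apply: (le_trans (ler_norm_sum _ _ _)); apply: ler_sum => t _.
  by rewrite normrM ler_wpM2r // ltW.
rewrite -mulr_sumr -mulrA ger_pMr // mulrC ler_pdivrMr // mul1r.
by rewrite /B; lra.
Qed.

(** * Gibbs' inequality *)

(** Sum [p * ln (q / p) <= q - p], a case of [ln y <= y - 1]; the right side sums to 0. The
    condition on supports keeps out the default value [ln 0 = 0]. *)
Lemma gibbs_inequality {R : realType} {T : finType} {p q : T -> R} :
    (forall t, 0 <= p t) -> (forall t, 0 <= q t) -> \sum_t q t = \sum_t p t ->
    (forall t, 0 < p t -> 0 < q t) ->
  \sum_t p t * ln (q t) <= \sum_t p t * ln (p t).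
Proof.
move=> p_ge0 q_ge0 pq pq_gt0.
rewrite -subr_ge0 -sumrB -oppr_le0 -sumrN.
apply: (@le_trans _ _ (\sum_t (q t - p t))); last by rewrite sumrB pq subrr.
apply: ler_sum => t _.
have := p_ge0 t; rewrite le_eqVlt => /predU1P[<-|pt_gt0].
  by rewrite !mul0r !subr0 oppr0.
have qt_gt0 := pq_gt0 t pt_gt0.
have : ln (1 + (q t / p t - 1)) <= q t / p t - 1.
  by apply: le_ln1Dx; have := divr_gt0 qt_gt0 pt_gt0; lra.
rewrite addrC subrK ln_div // => /(ler_wpM2l (ltW pt_gt0)).
by rewrite !mulrBr [p t * (_ / _)]mulrC divfK ?gt_eqF // mulr1; lra.
Qed.

(** * Multisets over a finite type in terms of multiplicities *)

Lemma mset_of_multiplicities {T : finType} (n : T -> nat) :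
  exists D : {mset T}%mset, forall t, D t = n t.
Proof.
exists (seq_mset (flatten [seq nseq (n t) t | t <- index_enum T])) => t.
rewrite mset_seqE count_flatten sumnE !big_map (bigD1 t) //=.
rewrite count_nseq /= eqxx mul1n big1 ?addn0 // => u /negPf ut.
by rewrite count_nseq /= ut.
Qed.

Lemma big_mset_count {T : finType} {R : Type} {idx : R}
    (op : Monoid.com_law idx) (P : pred T) (F : T -> R) (D : {mset T}%mset) :
  \big[op/idx]_(t <- D | P t) F t =
    \big[op/idx]_(t | P t) iterop (D t) op (F t) idx.
Proof.
rewrite -big_undup_iterop_count -big_filter big_uniq ?filter_uniq ?undup_uniq //=.
rewrite [RHS](bigID (fun t => t \in D)) /= [X in op _ X]big1 ?Monoid.mulm1.
  apply: eq_big => [t|t _]; first by rewrite mem_filter mem_undup.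
  by rewrite count_mem_mset.
by move=> t /andP[_ /mset_eq0P ->].
Qed.

Lemma count_mset {T : finType} (P : pred T) (D : {mset T}%mset) :
  count P D = (\sum_(t | P t) D t)%N.
Proof.
rewrite -sum1_count big_mset_count; apply: eq_bigr => t _.
by rewrite Monoid.iteropE /= iter_addn_0 mul1n.
Qed.

Lemma size_mset {T : finType} (D : {mset T}%mset) : size D = (\sum_t D t)%N.
Proof. by rewrite -count_predT count_mset. Qed.

Lemma size_mset_gt0 {T : choiceType} (D : {mset T}%mset) :
  (0 < size D)%N = (D != mset0).
Proof.
apply/idP/idP; first by apply: contraTneq => ->; rewrite enum_mset0.
apply: contra_neqT; rewrite -leqNgt leqn0 size_eq0 => /eqP D0.
by apply/msetP => t; rewrite mset0E -count_mem_mset D0.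
Qed.

(** * Likelihood, logarithm and entropy *)

Lemma likelihoodE {R : realType} {N : nat} (p : transaction N -> R)
    (D : dataset N) :
  likelihood p D = \prod_t p t ^+ D t.
Proof. by rewrite /likelihood big_mset_count. Qed.

Lemma ln_likelihood {R : realType} {N : nat} (p : transaction N -> R)
    (D : dataset N) : (forall t, (0 < D t)%N -> 0 < p t) ->
  ln (likelihood p D) = \sum_t (D t)%:R * ln (p t).
Proof.
move=> p_gt0; rewrite likelihoodE.
(* Positivity is carried along with the logarithm because [lnM] needs positive factors; where
   [D t = 0] the factor is 1, whatever [p t] is. *)
pose K (a b : R) := 0 < a /\ ln a = b.
suff [] : K (\prod_t p t ^+ D t) (\sum_t (D t)%:R * ln (p t)) by [].
apply: (big_ind2 K) => [|a b a' b' [a_gt0 <-] [a'_gt0 <-]|t _].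
- by rewrite /K ltr01 ln1.
- by rewrite /K mulr_gt0 // lnM.
- have [->|/p_gt0 pt_gt0] := posnP (D t); first by rewrite /K ltr01 ln1 mul0r.
  by rewrite /K exprn_gt0 // lnXn // mulr_natl.
Qed.

Lemma likelihood_gt0 {R : realType} {N : nat} (p : transaction N -> R)
    (D : dataset N) : (forall t, 0 <= p t) ->
  (0 < likelihood p D) <-> (forall t, (0 < D t)%N -> 0 < p t).
Proof.
move=> p_ge0; rewrite likelihoodE; split => [p_gt0 t Dt|p_gt0].
  rewrite lt_neqAle p_ge0 andbT; apply: contraTneq p_gt0 => pt0.
  by rewrite (bigD1 t) //= -pt0 expr0n gtn_eqF // mul0r ltxx.
apply: prodr_gt0 => t _.
by have [->|/p_gt0 pt_gt0] := posnP (D t); rewrite ?expr0 ?exprn_gt0.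
Qed.

Lemma log2_gt0E {R : realType} (x : R) : 0 < x -> log2 x = (ln x / ln 2)%:E.
Proof. by move=> x_gt0; rewrite /log2 lne_EFin. Qed.

Lemma ln2_gt0 {R : realType} : 0 < ln 2 :> R.
Proof. by rewrite ln_gt0 // ltr1n. Qed.

Lemma log2_0 {R : realType} : log2 (0 : R) = -oo%E.
Proof. by rewrite /log2 le0_lneNy // gt0_mulNye // lte_fin invr_gt0 ln2_gt0. Qed.

(** The default [ln 0 = 0] is harmless here: it agrees with the convention 0 log 0 = 0. *)
Lemma entropyE {R : realType} {N : nat} (p : transaction N -> R) :
  (forall t, 0 <= p t) ->
  entropy p = (- (\sum_t p t * ln (p t)) / ln 2)%:E.
Proof.
move=> p_ge0; rewrite /entropy mulNr EFinN mulr_suml -sumEFin; congr (- _)%E.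
apply: eq_bigr => t _.
have := p_ge0 t; rewrite le_eqVlt => /predU1P[<-|pt_gt0].
  by rewrite mul0e !mul0r.
by rewrite log2_gt0E // -EFinM mulrA.
Qed.

(** * Empirical distributions and the lower bound for the maximum entropy likelihood *)

Definition empirical (R : realType) {N : nat} (D : dataset N)
  (t : transaction N) : R := (D t)%:R / (size D)%:R.

Lemma empirical_satisfies (R : realType) (N k : nat) (C : 'I_k -> itemset N)
    (D : dataset N) : D != mset0 ->
  satisfies C (frequencies R C D) (empirical R D).
Proof.
move=> D_neq0; split; first split => [t|].
- by rewrite divr_ge0.
- rewrite -mulr_suml -natr_sum -size_mset divff //.
  by rewrite pnatr_eq0 -lt0n size_mset_gt0.
- move=> i; rewrite ffunE /fr /support_prob.
  by rewrite -mulr_suml -natr_sum -count_mset.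
Qed.

Lemma satisfies_convex {R : realType} {N k : nat} {C : 'I_k -> itemset N}
    {f : {ffun 'I_k -> R}} {p q : transaction N -> R} {e : R} :
    0 <= e <= 1 -> satisfies C f p -> satisfies C f q ->
  satisfies C f (fun t => (1 - e) * p t + e * q t).
Proof.
move=> /andP[e_ge0 e_le1] [[p_ge0 p1] pC] [[q_ge0 q1] qC].
split; first split => [t|].
- by rewrite addr_ge0 // mulr_ge0 // subr_ge0.
- by rewrite big_split /= -!mulr_sumr p1 q1; lra.
- move=> i; rewrite /support_prob big_split /= -!mulr_sumr.
  by rewrite [X in _ * X + _]pC [X in _ + _ * X]qC; lra.
Qed.

Lemma maxent_likelihood_ge {R : realType} {N k : nat} {C : 'I_k -> itemset N}
    {D : dataset N} {p : transaction N -> R} :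
    D != mset0 -> is_maxent C (frequencies R C D) p ->
  expR ((size D)%:R * \sum_t p t * ln (p t)) <= likelihood p D.
Proof.
move=> D_neq0 [p_sat p_max].
have q_sat := @empirical_satisfies R N k C D D_neq0.
set q := empirical R D in q_sat.
set h := \sum_t p t * ln (p t).
have size_gt0 : 0 < (size D)%:R :> R by rewrite ltr0n size_mset_gt0.
pose m e t := (1 - e) * p t + e * q t.
have [[p_ge0 p1] _] := p_sat; have [[q_ge0 q1] _] := q_sat.
have m_bound e : 0 < e < 1 -> expR ((size D)%:R * h) <= likelihood (m e) D.
  move=> /andP[e_gt0 e_lt1].
  have m_sat : satisfies C (frequencies R C D) (m e).
    by apply: satisfies_convex => //; lra.
  have [[m_ge0 m1] _] := m_sat.
  (* The mixture is positive on the supports of both [p] and [q], so Gibbs' inequality and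
     logarithms of likelihoods are available even if [p] vanishes on [D]. *)
  have m_gt0 t : 0 < p t \/ 0 < q t -> 0 < m e t.
    have p_ge0t := p_ge0 t; have q_ge0t := q_ge0 t; rewrite /m.
    have e1_gt0 : 0 < 1 - e by lra.
    case=> gt0; [apply: ltr_pwDl|apply: ltr_pwDr];
      by [apply: mulr_gt0|apply: mulr_ge0 => //; exact: ltW].
  have mD_gt0 t : (0 < D t)%N -> 0 < m e t.
    by move=> Dt; apply: m_gt0; right; rewrite /q divr_gt0 // ltr0n.
  have mL_gt0 : 0 < likelihood (m e) D by apply/likelihood_gt0.
  rewrite -[leRHS]lnK ?posrE // ler_expR ln_likelihood //.
  have -> : \sum_t (D t)%:R * ln (m e t)
            = (size D)%:R * \sum_t q t * ln (m e t).
    rewrite mulr_sumr; apply: eq_bigr => t _.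
    by rewrite mulrA /q /empirical [_ * (_ / _)]mulrC divfK // gt_eqF.
  rewrite ler_pM2l //.
  have gibbs : \sum_t p t * ln (m e t) <= h.
    by apply: gibbs_inequality => // [|t pt]; [rewrite m1|apply: m_gt0; left].
  have := p_max _ m_sat.
  rewrite !entropyE // lee_fin ler_pM2r ?invr_gt0 ?ln2_gt0 // lerN2 -/h.
  (* Maximality gives [h <= \sum_t m e t * ln (m e t)]. Splitting the mixture and bounding its [p]
     part by [(1 - e) * h] leaves [e * h <= e * \sum_t q t * ln (m e t)]. *)
  have -> : \sum_t m e t * ln (m e t) = (1 - e) * (\sum_t p t * ln (m e t))
            + e * \sum_t q t * ln (m e t).
    rewrite !mulr_sumr -big_split /=; apply: eq_bigr => t _.
    by rewrite [X in X * _]/m; ring.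
  have e1_ge0 : 0 <= 1 - e by lra.
  have := ler_wpM2l e1_ge0 gibbs.
  by move=> ? ?; rewrite -(ler_pM2l e_gt0); lra.
(* The limit is taken in the likelihood, a polynomial in [e], and not in its logarithm, which could
   diverge. *)
have m_cvg : (likelihood (m e) D @[e --> (0 : R)] --> likelihood (m 0) D)%classic.
  rewrite /likelihood; elim: (enum_mset D) => [|t s IHs].
    by rewrite big_nil; under eq_cvg do rewrite big_nil; exact: cvg_cst.
  rewrite big_cons; under eq_cvg do rewrite big_cons.
  apply: cvgM => //; rewrite /m; apply: cvgD; apply: cvgM; try exact: cvg_cst.
    by apply: cvgB; [exact: cvg_cst|exact: cvg_id].
  exact: cvg_id.
have -> : likelihood p D = likelihood (m 0) D.
  by apply: eq_bigr => t _; rewrite /m subr0 mul1r mul0r addr0.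
apply: (ler_cvg_to (cvg_cst _) (cvg_at_right_filter m_cvg)).
by near=> e; apply: m_bound; apply/andP; split.
Unshelve. all: by end_near.
Qed.

(** * Models whose mean log-likelihood depends only on the frequencies *)

Lemma frequencies_eq {R : realType} {N k : nat} (C : 'I_k -> itemset N)
    {D D' : dataset N} : D != mset0 -> D' != mset0 ->
    (forall i, size D * count (supports (C i)) D' =
               count (supports (C i)) D * size D')%N ->
  frequencies R C D' = frequencies R C D.
Proof.
rewrite -!size_mset_gt0 => D_gt0 D'_gt0 eqDD'; apply/ffunP => i; rewrite !ffunE.
apply/eqP; rewrite /fr eqr_div ?pnatr_eq0 -?lt0n //.
by rewrite -!natrM mulnC eqDD'.
Qed.

(** Constancy says that the linear form with coefficients [ln (s t) - c] vanishes on the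
    multiplicities of datasets that have the frequencies of [D] and the support of [p];
    [linear_form_vanish] carries this over to [p]. *)
Lemma constant_model_mean {R : realType} {N k : nat} {C : 'I_k -> itemset N}
    {D : dataset N} {s p : transaction N -> R} :
    D != mset0 -> (forall t, 0 <= s t) -> 0 < likelihood s D ->
    (forall D' : dataset N, D' != mset0 ->
       frequencies R C D' = frequencies R C D ->
       (((size D')%:R^-1)%:E * log2 (likelihood s D')
        = ((size D)%:R^-1)%:E * log2 (likelihood s D))%E) ->
    satisfies C (frequencies R C D) p ->
  (forall t, 0 < p t -> 0 < s t) /\
  ln (likelihood s D) = (size D)%:R * \sum_t p t * ln (s t).
Proof.
move=> D_neq0 s_ge0 sD_gt0 s_const [[p_ge0 p1] pC].
have size_gt0 : 0 < (size D)%:R :> R by rewrite ltr0n size_mset_gt0.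
pose c := ln (likelihood s D) / (size D)%:R.
(* The frequency constraints with denominators cleared: homogeneous and rational. *)
pose M (i : 'I_k) (t : transaction N) : rat :=
  (size D)%:R * (supports (C i) t)%:R - (count (supports (C i)) D)%:R.
(* Stated over a general ring: it serves over [R] for [p] and over [rat] for multiplicities. *)
have sumM (F : comNzRingType) (i : 'I_k) (x : transaction N -> F) :
    \sum_t ((size D)%:R * (supports (C i) t)%:R
             - (count (supports (C i)) D)%:R) * x t =
    (size D)%:R * \sum_(t | supports (C i) t) x t
    - (count (supports (C i)) D)%:R * \sum_t x t.
  rewrite !mulr_sumr [X in X - _]big_mkcond -sumrB; apply: eq_bigr => t _.
  rewrite mulrBl.
  by case: ifP => _; rewrite ?mulr1 // mulr0 mul0r.
have Mp i : \sum_t ratr (M i t) * p t = 0.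
  under eq_bigr do rewrite rmorphB rmorphM /= !ratr_nat.
  rewrite sumM p1; have := pC i; rewrite /support_prob ffunE /fr => ->.
  by rewrite mulrC divfK ?gt_eqF // mulr1 subrr.
have key (n : transaction N -> nat) :
    (forall i, \sum_t M i t * (n t)%:R = 0) ->
    (forall t, (0 < n t)%N = (0 < p t)) ->
    (forall t, 0 < p t -> 0 < s t) /\ \sum_t (n t)%:R * (ln (s t) - c) = 0.
  move=> Mn np.
  have [D' D'n] := mset_of_multiplicities n.
  have D'_neq0 : D' != mset0.
    apply/eqP => D'0; have : \sum_t p t = 0.
      apply: big1 => t _; apply/eqP; rewrite eq_le p_ge0 andbT leNgt -np -D'n.
      by rewrite D'0 mset0E.
    by rewrite p1 => /eqP; rewrite oner_eq0.
  have size'_gt0 : 0 < (size D')%:R :> R by rewrite ltr0n size_mset_gt0.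
  have frD' : frequencies R C D' = frequencies R C D.
    apply: frequencies_eq => // i; apply/eqP; rewrite -(eqr_nat rat) !natrM.
    rewrite (count_mset _ D') (size_mset D') !natr_sum -subr_eq0.
    under eq_bigr do rewrite D'n.
    under [in X in _ - X]eq_bigr do rewrite D'n.
    by rewrite -sumM; apply/eqP; exact: Mn.
  have := s_const D' D'_neq0 frD'; rewrite (log2_gt0E _ sD_gt0).
  have : 0 <= likelihood s D' by apply: prodr_ge0.
  (* A zero likelihood would make the left side [-oo], while the right side is finite. Hence [s] is
     positive on [D'], that is, on the support of [p]. *)
  rewrite le_eqVlt => /predU1P[<-|sD'_gt0].
    by rewrite log2_0 gt0_muleNy // lte_fin invr_gt0.
  rewrite (log2_gt0E _ sD'_gt0) -!EFinM => -[].
  rewrite !mulrA => /(mulIf (invr_neq0 (lt0r_neq0 ln2_gt0))).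
  have D's_gt0 := (likelihood_gt0 s D' s_ge0).1 sD'_gt0.
  rewrite ln_likelihood // [RHS]mulrC -/c => eqc.
  split=> [t pt_gt0|]; first by apply: D's_gt0; rewrite D'n np.
  under eq_bigr do rewrite mulrBr.
  rewrite sumrB -mulr_suml -natr_sum -eqc.
  have -> : (\sum_t n t)%N = size D'.
    by rewrite size_mset; apply: eq_bigr => t _; rewrite D'n.
  rewrite mulVKf ?gt_eqF //; apply/eqP; rewrite subr_eq0; apply/eqP.
  by apply: eq_bigr => t _; rewrite D'n.
split.
  (* Any precision will do: one dataset with the support of [p] suffices. *)
  have [d [n [_ Mn np _]]] := nat_kernel_approx ltr01 p_ge0 Mp.
  by have [] := key n Mn np.
have l0 := linear_form_vanish p_ge0 Mp (fun n Mn np => (key n Mn np).2).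
have -> : \sum_t p t * ln (s t) = c.
  apply/eqP; rewrite -subr_eq0 -[X in _ - X]mul1r -p1 mulr_suml -sumrB.
  by under eq_bigr do rewrite -mulrBr; rewrite l0.
by rewrite /c mulrC divfK // gt_eqF.
Qed.

Lemma fr_itv {R : realType} {N : nat} (X : itemset N) (D : dataset N) :
  D != mset0 -> 0 <= fr R X D <= 1.
Proof.
rewrite -size_mset_gt0 => D_gt0; rewrite divr_ge0 //=.
by rewrite ler_pdivrMr ?ltr0n // mul1r ler_nat count_size.
Qed.

(** * Comparison of the two likelihoods *)

Theorem theorem4p5 (R : realType) (N k : nat) (C : 'I_k -> itemset N)
    (r : {ffun 'I_k -> R} -> transaction N -> R)
    (r_model : is_model r)
    (r_const : forall (f : {ffun 'I_k -> R}) (D1 D2 : dataset N),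
       D1 != mset0 -> D2 != mset0 ->
       frequencies R C D1 = f -> frequencies R C D2 = f ->
       (((size D1)%:R^-1)%:E * log2 (likelihood (r f) D1)
        = ((size D2)%:R^-1)%:E * log2 (likelihood (r f) D2))%E)
    (D : dataset N) (D_neq0 : D != mset0)
    (pstar : transaction N -> R)
    (pstar_maxent : is_maxent C (frequencies R C D) pstar) :
  likelihood pstar D >= likelihood (r (frequencies R C D)) D.
Proof.
have [[p_ge0 p1] _] := pstar_maxent.1.
have [s_ge0 s1] : is_distribution (r (frequencies R C D)).
  by apply: r_model => i; rewrite ffunE; exact: fr_itv.
set s := r (frequencies R C D) in s_ge0 s1 *.
have : 0 <= likelihood s D by exact: prodr_ge0.
rewrite le_eqVlt => /predU1P[<-|sD_gt0]; first exact: prodr_ge0.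
have [s_gt0 lns] := constant_model_mean D_neq0 s_ge0 sD_gt0
  (fun D' D'_neq0 frD' => r_const _ D' D D'_neq0 D_neq0 frD' erefl)
  pstar_maxent.1.
apply: le_trans (maxent_likelihood_ge D_neq0 pstar_maxent).
(* Both likelihoods are compared with [expR] of [size D] times the negative entropy of [pstar] in
   nats; what remains is Gibbs' inequality for [pstar] and [s]. *)
rewrite -[leLHS]lnK ?posrE // ler_expR lns ler_wpM2l //.
by apply: gibbs_inequality; rewrite ?s1.
Qed.
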